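(* Let $G$ be a graph with maximum degree $\Delta(G)$ and minimum degree $\delta(G)$ such that $\Delta(G)\ge \delta(G)+1$. Then $C_{\delta(G)}(G)\le 2\Delta(G)-2\delta(G)+4$.
   Context: All graphs are finite, simple and undirected. For an integer $k\ge 1$, a set $S\subseteq V(G)$ is a $k$-dominating set of $G$ if every vertex of $V(G)\setminus S$ has at least $k$ neighbours in $S$. Two sets $U_1,U_2\subseteq V(G)$ form a $k$-coalition if neither $U_1$ nor $U_2$ is a $k$-dominating set of $G$, but $U_1\cup U_2$ is. A $k$-coalition partition of $G$ is a partition $\Theta$ of $V(G)$ into nonempty sets such that every set of $\Theta$ either is a $k$-dominating set of $G$ with exactly $k$ elements, or forms a $k$-coalition with some other set of $\Theta$. The $k$-coalition number $C_k(G)$ is the maximum number of sets in a $k$-coalition partition of $G$. *)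

(* Defs.v *)
From mathcomp Require Import all_boot.
Set Implicit Arguments.
Unset Strict Implicit.
Unset Printing Implicit Defensive.

(* A finite simple undirected graph is a symmetric irreflexive
   relation e on the finite vertex type T; the definitions
   below make sense for any e and do not carry these two properties. *)

Section Graph.
Variables (T : finType) (e : rel T).

Definition neighbors (x : T) : {set T} := [set y | e x y].

Definition degree (x : T) : nat := #|neighbors x|.

Definition max_degree : nat := \max_(x : T) degree x.

(* The default value #|T| bounds every degree, so it does not affect the
   minimum when T is nonempty. *)
Definition min_degree : nat := \big[minn/#|T|]_(x : T) degree x.

Definition k_dominating (k : nat) (S : {set T}) : bool :=
  [forall x in ~: S, k <= #|neighbors x :&: S|].

Definition k_coalition (k : nat) (U1 U2 : {set T}) : bool :=
  [&& ~~ k_dominating k U1, ~~ k_dominating k U2 & k_dominating k (U1 :|: U2)].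

(* [partition P setT] already requires the members of P to be nonempty. *)
Definition k_coalition_partition (k : nat) (P : {set {set T}}) : bool :=
  partition P [set: T] &&
  [forall U in P, (k_dominating k U && (#|U| == k))
     || [exists W in P, (W != U) && k_coalition k U W]].

(* Equal to 0 when the graph has no k-coalition partition. *)
Definition coalition_number (k : nat) : nat :=
  \max_(P : {set {set T}} | k_coalition_partition k P) #|P|.

End Graph.

(* Main.v *)
(* Fix a vertex x of minimum degree k. A k-dominating set contains x or all of
   N(x), so every coalition either involves the part X containing x, or covers
   N(x). If a vertex v witnesses that a set is not k-dominating, then all its
   coalition partners contain v or several neighbours of v, which bounds their
   number by D - k + 2, where D is the maximum degree. Away from X and its
   partners, the parts are: nothing; or two parts that together cover N(x); or
   one part U that contains N(x), with partners of U. In the last case either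
   the union of X and U is not k-dominating, and a single witness v bounds the
   partners of X and U simultaneously, or X and U are partners of each other
   and need not be counted separately. *)

Require Import Defs.
From mathcomp Require Import all_boot.
From mathcomp Require Import zify.

Set Implicit Arguments.
Unset Strict Implicit.
Unset Printing Implicit Defensive.

(** * Extremal degrees *)

Section Degrees.
Variables (T : finType) (e : rel T).

Lemma min_degree_le (v : T) : min_degree e <= degree e v.
Proof.
rewrite /min_degree; have := mem_index_enum v.
elim: (index_enum T) => [//|y s IHs]; rewrite inE big_cons geq_min.
by case/predU1P => [->|/IHs ->]; rewrite ?leqnn ?orbT.
Qed.

Lemma degree_le_max (v : T) : degree e v <= max_degree e.
Proof. exact: leq_bigmax. Qed.

Lemma min_degree_attained (v : T) : exists x, degree e x = min_degree e.
Proof.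
have [min_card|[x ->]] : min_degree e = #|T| \/ exists x, min_degree e = degree e x.
- rewrite /min_degree; apply: (big_ind (fun m => m = _ \/ exists x, m = _)).
  + by left.
  + by move=> m n hm hn; rewrite /minn; case: ifP.
  + by move=> x _; right; exists x.
(* If the minimum equals its default value [#|T|], then [v] attains it, as no degree exceeds
   [#|T|]. *)
- exists v; apply/eqP.
  by rewrite eqn_leq min_degree_le {1}min_card max_card.
- by exists x.
Qed.

End Degrees.

(** * Bounds on the number of coalition partners *)

Section Partners.
Variables (T : finType) (e : rel T) (k : nat) (P : {set {set T}}).
Hypotheses (trivP : trivIset P) (min_k : forall v, k <= degree e v).

Definition partners (U : {set T}) : {set {set T}} :=
  [set W in P | k_coalition e k U W].

(** The members of [F] are disjoint, so the double sum of indicators of [A] collapses to a single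
    sum over [cover F]. *)
Lemma sum_card_setI_le (F : {set {set T}}) (A : {set T}) :
  trivIset F -> \sum_(W in F) #|A :&: W| <= #|A|.
Proof.
move=> trivF.
have -> : \sum_(W in F) #|A :&: W| = \sum_(W in F) \sum_(y in W) (y \in A).
  apply: eq_bigr => W _; rewrite -sum1_card big_mkcond [RHS]big_mkcond.
  by apply: eq_bigr => y _; rewrite inE; case: (y \in A); case: (y \in W).
rewrite -(big_trivIset (E := fun y => (y \in A) : nat) F trivF) /=.
rewrite -sum1_card [X in _ <= X]big_mkcond /= [X in X <= _]big_mkcond /=.
by apply: leq_sum => y _; case: (y \in cover F); case: (y \in A).
Qed.

Lemma trivIset_eq (U W : {set T}) (y : T) :
  U \in P -> W \in P -> y \in U -> y \in W -> U = W.
Proof.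
by move=> UP WP yU yW; rewrite -(def_pblock trivP UP yU) (def_pblock trivP WP yW).
Qed.

(* From #|F| * (k - j) + j <= deg v, where j < k is the number of neighbours
   of v in U. *)
Lemma card_many_neighbors (F : {set {set T}}) (U : {set T}) (v : T) :
  F \subset P -> U \in P -> U \notin F -> #|neighbors e v :&: U| < k ->
  (forall W, W \in F -> k <= #|neighbors e v :&: U| + #|neighbors e v :&: W|) ->
  #|F| <= max_degree e - k + 1.
Proof.
move=> sFP UP UF ltk many.
have sub : U |: F \subset P by rewrite subUset sub1set UP.
have := sum_card_setI_le (neighbors e v) (trivIsetS sub trivP).
rewrite big_setU1 //=.
have : \sum_(W in F) (k - #|neighbors e v :&: U|)
       <= \sum_(W in F) #|neighbors e v :&: W|.
  by apply: leq_sum => W /many; rewrite leq_subLR.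
rewrite sum_nat_const; have := degree_le_max e v; have := min_k v.
(* With [m.+1] members and j neighbours of [v] in [U], one term k - j together with j gives k, and
   the other [m] terms are at least 1 each; hence k + [m] is at most the degree of [v]. *)
rewrite /degree; case: #|F| => [//|m].
have : m <= m * (k - #|neighbors e v :&: U|) by rewrite leq_pmulr ?subn_gt0.
rewrite mulSn; move: ltk.
move: (\sum_(_ in _) _) #|_ :&: U| #|neighbors e v| (max_degree e) => s j d D.
move: (m * _) => p; lia.
Qed.

Lemma k_dominating_neighbors (S : {set T}) (v : T) :
  k_dominating e k S -> v \notin S -> k <= #|neighbors e v :&: S|.
Proof. by move/forall_inP => dS vS; apply: dS; rewrite inE. Qed.

Lemma partner_neighbors (U W : {set T}) (v : T) :
  W \in partners U -> v \notin U -> v \notin W ->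
  k <= #|neighbors e v :&: U| + #|neighbors e v :&: W|.
Proof.
rewrite inE => /andP[_ /and3P[_ _ dUW]] vU vW.
have := k_dominating_neighbors dUW.
move=> /(_ v); rewrite inE negb_or vU vW setIUr => /(_ isT) /leq_trans; apply.
by rewrite cardsU leq_subr.
Qed.

Lemma partners_irr (U : {set T}) : U \notin partners U.
Proof.
by rewrite inE /k_coalition setUid; case: (k_dominating e k U); rewrite ?andbF.
Qed.

Lemma partnersC (U W : {set T}) :
  U \in P -> W \in partners U -> U \in partners W.
Proof.
by move=> UP; rewrite !inE UP /k_coalition setUC => /andP[_ /and3P[-> -> ->]].
Qed.

Lemma k_dominatingP (S : {set T}) :
  reflect (exists2 v, v \notin S & #|neighbors e v :&: S| < k)
          (~~ k_dominating e k S).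
Proof.
rewrite /k_dominating negb_forall_in.
by apply: (iffP exists_inP) => -[v]; rewrite ?inE -?ltnNge => vS ltk;
   exists v; rewrite ?inE -?ltnNge.
Qed.

(** One vertex [v] that [X :|: U] fails to dominate serves for the partners of both sets: each
    partner contains [v] or supplies the neighbours of [v] that are missing. *)
Lemma card_partnersU (X U : {set T}) :
  X \in P -> U \in P -> ~~ k_dominating e k (X :|: U) ->
  #|partners X :|: partners U| <= max_degree e - k + 2.
Proof.
(* Let [X] be the set with at least as many neighbours of [v]. What a partner of [U] must supply
   then also suffices for [X], so all partners are counted against [X]. *)
wlog leUX : X U / exists2 v, v \notin X :|: U &
    #|neighbors e v :&: (X :|: U)| < k /\
    #|neighbors e v :&: U| <= #|neighbors e v :&: X|.
  move=> wl XP UP /[dup] nd /k_dominatingP[v vXU ltk].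
  case/orP: (leq_total #|neighbors e v :&: U| #|neighbors e v :&: X|) => le.
    by apply: wl => //; exists v.
  rewrite setUC; rewrite setUC in nd vXU ltk.
  by apply: wl => //; exists v.
move=> XP UP nd; have [v vXU [ltk le]] := leUX.
move: vXU; rewrite inE negb_or => /andP[vX vU].
set F := partners X :|: partners U.
have FP W : W \in F -> W \in P by rewrite !inE => /orP[] /andP[].
have XF : X \notin F.
  rewrite inE negb_or partners_irr; apply: contra nd.
  by rewrite inE setUC => /andP[_ /and3P[]].
(* Disjointness allows only one partner to contain [v]; it raises the bound from + 1 to + 2. *)
pose Fv := [set W in F | v \in W].
have Fv1 : #|Fv| <= 1.
  apply/card_le1_eqP => W W'; rewrite !(inE, in_set) -/F.
  move=> /andP[WF vW] /andP[WF' vW'].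
  apply: trivIset_eq vW' vW; apply: FP; by rewrite !inE.
have F'le : #|F :\: Fv| <= max_degree e - k + 1.
  apply: (@card_many_neighbors _ X v) => //.
  - by apply/subsetP => W /setDP[/FP].
  - by rewrite inE (negbTE XF) andbF.
  - by apply: leq_ltn_trans ltk; apply/subset_leq_card/setIS/subsetUl.
  - move=> W /setDP[WF]; rewrite inE WF /= => vW.
    case/setUP: WF => [/partner_neighbors->//|/partner_neighbors nU].
    by apply: leq_trans (nU v vU vW) _; rewrite leq_add2r.
rewrite -(cardsID Fv F) addnC (_ : 2 = 1 + 1) // addnA leq_add //.
by apply: leq_trans Fv1; apply/subset_leq_card/subsetIr.
Qed.

Lemma partners_dominating (U : {set T}) :
  k_dominating e k U -> partners U = set0.
Proof.
by move=> dU; apply/setP => W; rewrite !inE /k_coalition dU /= andbF.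
Qed.

Lemma card_partners (U : {set T}) :
  U \in P -> #|partners U| <= max_degree e - k + 2.
Proof.
move=> UP; have [/partners_dominating ->|nd] := boolP (k_dominating e k U).
  by rewrite cards0.
by rewrite -(setUid (partners U)) card_partnersU // setUid.
Qed.

(** The vertex [x] has only [k] neighbours, so having [k] of them in [S] means having all of them
    there. *)
Lemma neighbors_sub_dominating (x : T) (S : {set T}) :
  degree e x = k -> k_dominating e k S -> x \notin S -> neighbors e x \subset S.
Proof.
move=> degx dS xS; apply/setIidPl/eqP.
by rewrite eqEcard subsetIl -[X in X <= _]/(degree e x) degx
           k_dominating_neighbors.
Qed.

End Partners.

(** * Counting the parts around a vertex of minimum degree *)

Section CoalitionPartition.
Variables (T : finType) (e : rel T) (k : nat) (P : {set {set T}}) (x : T).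
Hypotheses (min_k : forall v, k <= degree e v) (degx : degree e x = k).
Hypothesis coalP : k_coalition_partition e k P.

Let partP : partition P [set: T]. Proof. by case/andP: coalP. Qed.
Let trivP : trivIset P. Proof. by case/and3P: partP. Qed.

(** For [k = 0] every set is dominating, so no coalition exists, and a nonempty part cannot have 0
    elements. This gives [x] a neighbour. *)
Lemma coalition_min_degree_gt0 : 0 < k.
Proof.
case: (posnP k) => // k0; have := mem_pblock P x.
rewrite (cover_partition partP) inE => xX.
have XP : pblock P x \in P by rewrite pblock_mem // (cover_partition partP).
have dom S : k_dominating e k S by apply/forall_inP => v _; rewrite k0.
case/andP: coalP => _ /forall_inP /(_ _ XP) /orP[/andP[_]|/exists_inP[W _]].
  by rewrite k0 cards_eq0 => /eqP X0; rewrite X0 inE in xX.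
by rewrite /k_coalition dom andbF.
Qed.

Variable X : {set T}.
Hypotheses (XP : X \in P) (xX : x \in X).

Local Notation partners := (partners e k P).
Local Notation N := (neighbors e x).

Let notin_x (W : {set T}) : W \in P -> W != X -> x \notin W.
Proof.
by move=> WP; apply: contra => xW; apply/eqP/(trivIset_eq trivP WP XP xW xX).
Qed.

(** A dominating part, or a dominating union of two parts, that avoids [X] misses [x] and so
    contains [N]. *)
Lemma part_cases (W : {set T}) : W \in P ->
  [\/ W = X, W \in partners X, N \subset W |
   exists2 W', W' \in P & W' != X /\ W' \in partners W /\ N \subset W :|: W'].
Proof.
move=> WP; have [->|neW] := eqVneq W X; first by constructor 1.
have xW := notin_x WP neW.
case/andP: coalP => _ /forall_inP /(_ _ WP) /orP[/andP[dW _]|].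
  by constructor 3; apply: neighbors_sub_dominating dW xW.
case/exists_inP => W' W'P /andP[_ co].
have W'W : W' \in partners W by rewrite inE W'P.
have [E|neW'] := eqVneq W' X; first by constructor 2; rewrite partnersC // -E.
constructor 4; exists W' => //; do 2!split=> //.
apply: (neighbors_sub_dominating degx); first by case/and3P: co.
by rewrite inE negb_or xW notin_x.
Qed.

Let N_gt0 : exists y, y \in N.
Proof.
apply/card_gt0P; rewrite -[#|_|]/(degree e x) degx; exact: coalition_min_degree_gt0.
Qed.

Lemma card_partition_neighbors_in_part (U : {set T}) :
  U \in P -> U != X -> N \subset U -> k < max_degree e ->
  #|P| <= 2 * max_degree e - 2 * k + 4.
Proof.
move=> UP neU NU ltk.
(* The neighbour [y] identifies [U] as the only part that can contain [N] or help to cover it in a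
   pair. *)
have [y yN] := N_gt0; have yU := subsetP NU y yN.
have sub : P \subset [set X; U] :|: (partners X :|: partners U).
  apply/subsetP => W WP; rewrite !in_setU !in_set1.
  have eqU V : V \in P -> y \in V -> V = U.
    by move=> VP yV; apply: (trivIset_eq trivP) yV yU.
  case: (part_cases WP) => [->|->|/subsetP/(_ y yN)/(eqU _ WP)->|].
  - by rewrite eqxx.
  - by rewrite orbT.
  - by rewrite eqxx !orbT.
  case=> W' W'P [_ [W'W /subsetP/(_ y yN)]].
  case/setUP=> [/(eqU _ WP)->|/(eqU _ W'P) E]; first by rewrite eqxx !orbT.
  by rewrite -E (partnersC WP W'W) !orbT.
have pX := card_partners trivP min_k XP.
have pU := card_partners trivP min_k UP.
have small : #|partners X :|: partners U| <= max_degree e - k + 2 ->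
    #|P| <= 2 * max_degree e - 2 * k + 4.
  move=> small; apply: leq_trans (subset_leq_card sub) _.
  apply: leq_trans (leq_card_setU _ _) _; rewrite cards2 eq_sym neU.
  by apply: leq_trans (leq_add (leqnn _) small) _; clear -ltk; lia.
have [dXU|nd] := boolP (k_dominating e k (X :|: U)); last first.
  exact/small/(card_partnersU trivP).
have [dX|ndX] := boolP (k_dominating e k X).
  by apply: small; rewrite (partners_dominating P dX) set0U.
have [dU|ndU] := boolP (k_dominating e k U).
  by apply: small; rewrite (partners_dominating P dU) setU0.
(* Now [X] and [U] are partners of each other, so the two families of partners already include them,
   and twice D - k + 2 is exactly the bound. *)
have UX : U \in partners X by rewrite inE UP /k_coalition ndX ndU.
have {}sub : P \subset partners X :|: partners U.
  apply: subset_trans sub _; rewrite subUset subxx andbT subUset !sub1set !in_setU.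
  by rewrite UX (partnersC XP UX) orbT.
apply: leq_trans (subset_leq_card sub) _.
apply: leq_trans (leq_card_setU _ _) _.
by apply: leq_trans (leq_add pX pU) _; clear -ltk; lia.
Qed.

Lemma card_partition_neighbors_split :
  (forall U, U \in P -> U != X -> ~~ (N \subset U)) -> k < max_degree e ->
  #|P| <= 2 * max_degree e - 2 * k + 4.
Proof.
move=> split ltk; have pX := card_partners trivP min_k XP.
(* Three extra parts fit because [k < max_degree e]: the total 3 + (D - k + 2) needs D - k to be at
   least 1. *)
have bound (A : {set {set T}}) : #|A| <= 3 -> P \subset A :|: partners X ->
    #|P| <= 2 * max_degree e - 2 * k + 4.
  move=> A3 sub; apply: leq_trans (subset_leq_card sub) _.
  apply: leq_trans (leq_card_setU _ _) _.
  by apply: leq_trans (leq_add A3 pX) _; clear -ltk; lia.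
have [sub|/subsetPn[W0 W0P]] := boolP (P \subset X |: partners X).
  by apply: bound sub; rewrite cards1.
rewrite in_setU in_set1 negb_or => /andP[neW0 W0X].
have [E|pW0|NW0|[W0' W0'P [neW0' [_ NW0]]]] := part_cases W0P.
- by rewrite E eqxx in neW0.
- by rewrite pW0 in W0X.
- by case/negP: (split _ W0P neW0).
apply: (bound [set X; W0; W0']).
  apply: leq_trans (leq_card_setU _ _) _; rewrite cards2 cards1.
  by case: (_ != _).
apply/subsetP => W WP; rewrite !in_setU !in_set1.
have [//|->|NW|[W' W'P [neW' [_ NW]]]] := part_cases WP.
- by move=> ->; rewrite eqxx.
- by rewrite orbT.
- have [->|/(split _ WP)] := eqVneq W X; first by rewrite ?eqxx.
  by rewrite NW.
have [//|neX] := eqVneq W X.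
(* A part [W] other than [W0] and [W0'] is disjoint from [N], which these two cover; so [W'] alone
   would contain [N], against [split]. *)
have [//|ne0] := eqVneq W W0; have [//|ne0'] := eqVneq W W0'.
case/negP: (split _ W'P neW'); apply/subsetP => y yN.
case/setUP: (subsetP NW y yN) => // yW.
case/setUP: (subsetP NW0 y yN) => yW0.
- by rewrite (trivIset_eq trivP WP W0P yW yW0) eqxx in ne0.
- by rewrite (trivIset_eq trivP WP W0'P yW yW0) eqxx in ne0'.
Qed.

Lemma card_coalition_partition : k < max_degree e ->
  #|P| <= 2 * max_degree e - 2 * k + 4.
Proof.
move=> ltk.
have [/exists_inP[U UP /andP[neU NU]]|] :=
  boolP [exists U in P, (U != X) && (N \subset U)].
  exact: card_partition_neighbors_in_part neU NU ltk.
rewrite negb_exists_in => /forall_inP noU.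
apply: card_partition_neighbors_split => // U UP neU.
by have := noU U UP; rewrite neU.
Qed.

End CoalitionPartition.

Theorem theorem4 (T : finType) (e : rel T)
    (e_sym : symmetric e) (e_irr : irreflexive e)
    (lt_degrees : min_degree e + 1 <= max_degree e) :
  coalition_number e (min_degree e)
    <= 2 * max_degree e - 2 * min_degree e + 4.
Proof.
have ltk : min_degree e < max_degree e by rewrite -addn1.
apply/bigmax_leqP => P coalP.
(* A graph without vertices has maximum degree 0, which [ltk] excludes. *)
have [/card0_eq T0|/card_gt0P[v _]] := posnP #|T|.
  by move: ltk; rewrite /max_degree big1 // => v; have := T0 v.
have [x degx] := min_degree_attained e v.
have partP : partition P [set: T] by case/andP: coalP.
have covx : x \in cover P by rewrite (cover_partition partP).
have xX : x \in pblock P x by rewrite mem_pblock.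
exact: (card_coalition_partition (min_degree_le e) degx coalP
          (pblock_mem covx) xX ltk).
Qed.
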